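(* For every integer $e\geq 1$, with $q=2^{2e+1}$, the graph $\mathcal{G}_q(V,E)$ constructed from the Suzuki group $Sz(q)$ is an $egr(q(q^2+1),\,q,\,5,\,\lambda)$ for some $\lambda\geq q-1$.
   Context: All graphs are simple. An $egr(v,k,g,\lambda)$ (edge-girth-regular graph) is a $k$-regular graph of order (number of vertices) $v$ and girth $g$ such that each of its edges is contained in exactly $\lambda$ distinct $g$-cycles (cycles of length $g$). Construction of $\mathcal{G}_q(V,E)$. Let $q=2^{2e+1}$ with $e$ a strictly positive integer, and let $G\cong Sz(q)$ be the Suzuki group in its natural (2-transitive) action on the Suzuki–Tits ovoid $\mathcal{D}$ of $PG(3,q)$, which has $q^2+1$ points. A circle of $\mathcal{D}$ is the intersection of $\mathcal{D}$ with a plane of $PG(3,q)$ meeting $\mathcal{D}$ in more than one point. Let $G_1\cong E_q:C_{q-1}$ be the stabilizer in $G$ of a circle of $\mathcal{D}$ ($E_q$ is an elementary abelian group of order $q$, $C_{q-1}$ a cyclic group of order $q-1$). The orbits of $G_1$ on $\mathcal{D}$ have sizes $1$, $q$ and $q^2-q$; the point $n$ forming the orbit of size $1$ is called the nucleus of the circle. Pick a point $p$ in the orbit of size $q$, and let $G_2$ be the setwise stabilizer of $\{n,p\}$ in $G$. Then $G_2\cong D_{2(q-1)}$ (dihedral of order $2(q-1)$) and $G_1\cap G_2\cong C_{q-1}$ has index $2$ in $G_2$. The graph $\mathcal{G}_q(V,E)$ has as vertex set $V$ the set of right cosets $G_1g$ ($g\in G$) and as edge set $E$ the set of right cosets $G_2h$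 ($h\in G$); the vertex $G_1g$ is on the edge $G_2h$ if and only if $G_1g\cap G_2h\neq\emptyset$ (each edge contains exactly two vertices). *)

(* Defs.v *)
From mathcomp Require Import all_boot all_fingroup all_algebra all_character.

Set Implicit Arguments.
Unset Strict Implicit.
Unset Printing Implicit Defensive.

Import GRing.Theory.
Local Open Scope ring_scope.

(* A graph is kept as an incidence structure, because the edges of the graph
   below are cosets rather than pairs of vertices. *)
Record graph (T U : finType) := Graph {
  verts : {set T};
  edges : {set U};
  inc : T -> U -> bool
}.

Definition ends (T U : finType) (X : graph T U) (a : U) : {set T} :=
  [set x in verts X | inc X x a].

Definition simple_graph (T U : finType) (X : graph T U) : Prop :=
  {in edges X, forall a, #|ends X a| = 2%N} /\ {in edges X &, injective (ends X)}.

Definition adj (T U : finType) (X : graph T U) : rel T :=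
  fun x y => [exists a in edges X, ends X a == [set x; y]].

Definition regular (T U : finType) (X : graph T U) (k : nat) : Prop :=
  {in verts X, forall x, #|[set a in edges X | inc X x a]| = k}.

(* An n-cycle is identified with the set of its edges, so that it is counted
   once, whatever its starting vertex and its orientation. *)
Definition is_cycle (T U : finType) (X : graph T U) (n : nat) (C : {set U}) :
    bool :=
  (2 < n)%N &&
  [exists s : n.-tuple T,
    [&& all [in verts X] s, uniq s, path.cycle (adj X) s &
        C == [set a in edges X | [exists x in s, ends X a == [set x; next s x]]]]].

Definition has_girth (T U : finType) (X : graph T U) (g : nat) : Prop :=
  (exists C, is_cycle X g C) /\ (forall n C, is_cycle X n C -> (g <= n)%N).

Definition egr (T U : finType) (X : graph T U) (v k g lambda : nat) : Prop :=
  [/\ simple_graph X,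
      #|verts X| = v,
      regular X k,
      has_girth X g
    & {in edges X, forall a, #|[set C | is_cycle X g C & a \in C]| = lambda}].

Definition coset_graph (gT : finGroupType) (G G1 G2 : {group gT}) :
    graph {set gT} {set gT} :=
  Graph (rcosets G1 G) (rcosets G2 G) (fun x a => x :&: a != set0).

Definition mx4 (F : finFieldType) (rows : seq (seq F)) : 'M[F]_4 :=
  \matrix_(i, j) (nth [::] rows i)`_j.

Definition rv4 (F : finFieldType) (z y x t : F) : 'rV[F]_4 :=
  \row_j [:: z; y; x; t]`_j.

(* When #|F| = 2 ^ (2 * e + 1), the square of theta is x |-> x ^+ 2. *)
Definition theta (F : finFieldType) (e : nat) (x : F) : F := x ^+ (2 ^ e.+1).

(* Suzuki's generators of Sz(q), acting on row vectors from the right, as in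
   Huppert and Blackburn, Finite Groups III, chapter XI, section 3. *)
Definition suzukiS (F : finFieldType) (e : nat) (a b : F) : 'M[F]_4 :=
  let t := theta e in
  mx4 [:: [:: 1;                             0;           0; 0];
          [:: a;                             1;           0; 0];
          [:: b;                             t a;         1; 0];
          [:: a ^+ 2 * t a + a * b + t b;    a * t a + b; a; 1]].

Definition suzukiM (F : finFieldType) (e : nat) (l : F) : 'M[F]_4 :=
  diag_mx (rv4 (l ^+ (1 + 2 ^ e)) (l ^+ (2 ^ e))
               (l ^- (2 ^ e)) (l ^- (1 + 2 ^ e))).

Definition suzukiT (F : finFieldType) : 'M[F]_4 :=
  mx4 [:: [:: 0; 0; 0; 1];
          [:: 0; 0; 1; 0];
          [:: 0; 1; 0; 0];
          [:: 1; 0; 0; 0]].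

Definition suzuki_gens (F : finFieldType) (e : nat) : {set {'GL_4[F]}} :=
  [set g : {'GL_4[F]} |
    [|| [exists a, exists b, GLval g == suzukiS e a b],
        [exists l, (l != 0) && (GLval g == suzukiM e l)]
      | GLval g == suzukiT F]].

(* The only scalar matrix in this group is the identity (every generator has
   determinant 1, and 4 is coprime to q - 1), so it is also a group of
   projectivities. *)
Definition Sz (F : finFieldType) (e : nat) : {group {'GL_4[F]}} :=
  <<suzuki_gens F e>>%G.

(* Points and planes of PG(3, q) are represented by the sets of row vectors of
   the corresponding subspaces, of dimension 1 and 3, of F^4. *)
Definition PG3act (F : finFieldType) := ('MR (GLrepr F 3))^*%act.

Definition ovoid (F : finFieldType) (e : nat) : {set {set 'rV[F]_4}} :=
  rowg (rv4 1 0 0 0) |: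
  [set rowg (rv4 (x * y + x ^+ 2 * theta e x + theta e y) y x 1)
     | x : F, y : F].

Definition is_plane (F : finFieldType) (P : {set 'rV[F]_4}) : Prop :=
  exists2 A : 'M[F]_4, \rank A = 3%N & P = rowg A.

Definition is_circle (F : finFieldType) (e : nat)
    (C : {set {set 'rV[F]_4}}) : Prop :=
  exists P : {set 'rV[F]_4},
    [/\ is_plane P, C = [set x in ovoid F e | x \subset P] & (1 < #|C|)%N].

Definition circle_stab (F : finFieldType) (e : nat)
    (C : {set {set 'rV[F]_4}}) : {group {'GL_4[F]}} :=
  'N_(Sz F e)(C | PG3act F)%G.

Definition pair_stab (F : finFieldType) (e : nat)
    (n p : {set 'rV[F]_4}) : {group {'GL_4[F]}} :=
  'N_(Sz F e)([set n; p] | PG3act F)%G.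

Definition suzuki_graph (F : finFieldType) (e : nat)
    (C : {set {set 'rV[F]_4}}) (n p : {set 'rV[F]_4}) :
    graph {set {'GL_4[F]}} {set {'GL_4[F]}} :=
  coset_graph (Sz F e) (circle_stab e C) (pair_stab e n p).

(* Main.v *)
Require Import Defs.
From mathcomp Require Import all_boot all_fingroup all_algebra all_character.
From mathcomp Require Import finfield ring.

(** The whole group is used through its action on the q^2 + 1 points of the
ovoid.  A vertex of the graph is a circle together with its nucleus, and an
edge is an unordered pair of points: the circles with nuclei m and r are
joined exactly when each of them passes through the nucleus of the other.
Everything therefore depends on one ternary relation between points: r and s
lie on a common circle with nucleus m.

For an abstract group with such a configuration ([nucleus_graph_egr]) the
order and the valency follow from Lagrange's theorem, and the number of
pentagons through an edge is constant because the group permutes the edges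
transitively.  Two neighbours of a vertex with the same nucleus coincide, so
the nuclei of a triangle or of a quadrangle are distinct and satisfy a
cyclic system of conditions on the ternary relation; conversely five distinct
points satisfying the cyclic system are the nuclei of a pentagon.

For the Suzuki group, write inf for the point (1 : 0 : 0 : 0) and (x, y) for
the affine points.  To each ovoid point m belongs a line through m, spanned by
[pvec m] and [qvec m]; these lines form the Lueneburg spread, and the three
kinds of generators preserve it ([Sz_moves]).  The circle with nucleus m
through r is the section by the plane spanned by the line of m and by r
([coplanar], [circleP]).  At inf these planes are x = constant, so after
moving two points to inf and (0, 0) by double transitivity ([Sz_2trans]) all
conditions are read off from coordinates: triangles are impossible at once,
and a quadrangle inf, (0, 0), (x, 0), (0, v) would need theta v = 0
([coplanar_no_quadrangle]).

Pentagons exist because the points over the field with two elements form one: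
inf, (0, 0), (1, 0), (1, 1), (0, 1), consecutively, for every q
([pentagon_coplanar]).  The torus fixes inf and (0, 0) and moves (1, 0) to
every (l, 0) with l <> 0, which produces q - 1 different pentagons through one
edge. *)

Set Implicit Arguments.
Unset Strict Implicit.
Unset Printing Implicit Defensive.

(** * Automorphisms and cycle counts *)

Section GraphAutomorphism.
Variables (T U : finType) (X : graph T U) (f : T -> T) (h : U -> U).
Hypotheses (f_inj : injective f) (h_inj : injective h).
Hypothesis verts_aut : forall x, (f x \in verts X) = (x \in verts X).
Hypothesis edges_aut : forall a, (h a \in edges X) = (a \in edges X).
Hypothesis inc_aut : forall x a, inc X (f x) (h a) = inc X x a.

Let imset2 x y : f @: [set x; y] = [set f x; f y].
Proof. by rewrite imsetU1 imset_set1. Qed.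

Lemma ends_aut a : ends X (h a) = f @: ends X a.
Proof.
apply/setP=> y; rewrite -[y](f_invF f_inj) mem_imset //.
by rewrite !inE verts_aut inc_aut.
Qed.

Lemma adj_aut x y : adj X (f x) (f y) = adj X x y.
Proof.
have endsE a : (ends X (h a) == [set f x; f y]) = (ends X a == [set x; y]).
  by rewrite ends_aut -imset2 (inj_eq (imset_inj f_inj)).
apply/existsP/existsP=> -[a /andP[Ea eqa]]; last first.
  by exists (h a); rewrite edges_aut Ea endsE.
exists (invF h_inj a).
by rewrite -edges_aut -endsE f_invF Ea.
Qed.

Lemma is_cycle_aut k D : is_cycle X k D -> is_cycle X k (h @: D).
Proof.
case/andP=> k_gt2 /existsP[s /and4P[Vs Us Cs /eqP->]].
rewrite /is_cycle k_gt2; apply/existsP; exists (map_tuple f s) => /=.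
apply/and4P; split.
- by rewrite all_map; apply: sub_all Vs => x /=; rewrite verts_aut.
- by rewrite map_inj_uniq.
- by rewrite cycle_map (eq_cycle (e' := adj X)) // => x y; apply: adj_aut.
apply/eqP/setP=> a; rewrite -[a](f_invF h_inj) mem_imset // !inE edges_aut.
congr (_ && _); apply/existsP/existsP=> -[x /andP[sx eqx]]; last first.
  case/mapP: sx eqx => y sy -> eqy; exists y; rewrite sy /=.
  move: eqy; rewrite next_map // ends_aut -imset2.
  by rewrite (inj_eq (imset_inj f_inj)).
exists (f x); rewrite map_f //= next_map // ends_aut (eqP eqx).
by rewrite imset2.
Qed.

Lemma leq_card_cycles_aut k a :
  (#|[set D | is_cycle X k D & a \in D]| <=
     #|[set D | is_cycle X k D & h a \in D]|)%N.
Proof.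
rewrite -(card_imset _ (imset_inj h_inj)); apply/subset_leq_card/subsetP=> D.
case/imsetP=> C; rewrite !inE => /andP[cC aC] ->.
by rewrite is_cycle_aut //= imset_f.
Qed.

End GraphAutomorphism.

Section CosetGraph.
Local Open Scope group_scope.
Variables (gT : finGroupType) (G G1 G2 : {group gT}).
Local Notation X := (coset_graph G G1 G2).

(** Right multiplication by elements of [G] acts transitively on the cosets of
[G2]; the two inequalities come from an element and from its inverse. *)
Lemma card_cycles_coset_graph k :
  {in edges X &, forall a b, #|[set D | is_cycle X k D & a \in D]| =
                             #|[set D | is_cycle X k D & b \in D]|}.
Proof.
have mem_rcosetsM (H : {group gT}) g x : g \in G ->
    (x :* g \in rcosets H G) = (x \in rcosets H G).
  have imp y u : u \in G -> y \in rcosets H G -> y :* u \in rcosets H G.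
    move=> Gu /rcosetsP[v Gv ->]; rewrite -rcosetM.
    by apply/rcosetsP; exists (v * u) => //; rewrite groupM.
  move=> Gg; apply/idP/idP=> [|/imp->//].
  by move/(imp _ _ (groupVr Gg)); rewrite -rcosetM mulgV rcoset1.
have leq_card : {in edges X &, forall a b,
    (#|[set D | is_cycle X k D & a \in D]| <=
       #|[set D | is_cycle X k D & b \in D]|)%N}.
  move=> _ _ /rcosetsP[g Gg ->] /rcosetsP[h Gh ->].
  have Gu : g^-1 * h \in G by rewrite groupM ?groupV.
  have inj : injective (fun A : {set gT} => A :* (g^-1 * h)) by apply: rcoset_inj.
  have -> : G2 :* h = G2 :* g :* (g^-1 * h) by rewrite -rcosetM mulKVg.
  apply: (@leq_card_cycles_aut _ _ X _ _ inj inj) => [x|a|x a]; try exact: mem_rcosetsM.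
  rewrite /=; set u := g^-1 * h.
  have -> : x :* u :&: a :* u = (x :&: a) :* u.
    by apply/setP=> z; rewrite inE !mem_rcoset inE.
  by rewrite -!card_gt0 card_rcoset.
by move=> a b Ea Eb; apply/eqP; rewrite eqn_leq !leq_card.
Qed.

End CosetGraph.

(** * Coset graphs of groups acting on points with circles *)

Lemma eq_set2 (T : finType) (a b c d : T) :
  [set a; b] = [set c; d] -> a = c /\ b = d \/ a = d /\ b = c.
Proof.
move=> eqs.
have: a \in [set c; d] by rewrite -eqs set21.
have: b \in [set c; d] by rewrite -eqs set22.
have: c \in [set a; b] by rewrite eqs set21.
have: d \in [set a; b] by rewrite eqs set22.
rewrite !inE => Hd Hc Hb Ha.
case/orP: Ha => /eqP ?; case/orP: Hb => /eqP ?; subst; auto.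
  by left; split=> //; case/orP: Hd => /eqP.
by right; split=> //; case/orP: Hc => /eqP.
Qed.

Lemma adj_sym (T U : finType) (X : graph T U) x y : adj X x y = adj X y x.
Proof. by rewrite /adj setUC. Qed.

(** Here [n] is the nucleus of a circle through [p], [G1] is the stabiliser of
that circle, and [t] exchanges [n] and [p].  By [fix_np], a circle is
determined by its nucleus and one further point. *)
Section NucleusGraph.
Local Open Scope group_scope.
Variables (aT : finGroupType) (D : {group aT}) (rT : finType) (to : action D rT).
Variables (G G1 : {group aT}) (n p : rT) (t : aT).
Hypotheses (sGD : G \subset D) (sG1G : G1 \subset G).
Hypothesis fix_n : {in G1, forall g, to n g = n}.
Hypothesis fix_np : {in G, forall g, to n g = n -> to p g = p -> g \in G1}.
Hypothesis neq_np : n != p.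
Hypotheses (Gt : t \in G) (swap_n : to n t = p) (swap_p : to p t = n).

Local Notation G2 := ('N_G([set n; p] | to)%G).
Local Notation X := (coset_graph G G1 G2).

(** A common element of [G] carries the base circle to a circle with nucleus [m]
through [r] and [s]; transitivity of [G1] on its circle lets the first point be
the image of [p] itself. *)
Definition cocircular m r s : Prop :=
  exists x h, [/\ x \in G, h \in G1, m = to n x, r = to p x & s = to p (h * x)].

Let toM x : {in G &, forall g h, to x (g * h) = to (to x g) h}.
Proof. by move=> g h Gg Gh; rewrite actMin ?(subsetP sGD). Qed.

Let toK x g h : g \in G -> h \in G -> to x g = to x h -> to x (g * h^-1) = x.
Proof.
by move=> Gg Gh eqx; rewrite toM ?groupV // eqx actKin ?(subsetP sGD).
Qed.

Let G1G g : g \in G1 -> g \in G. Proof. exact: (subsetP sG1G). Qed.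

Lemma rcoset_fix_np x y : x \in G -> y \in G ->
  to n x = to n y -> to p x = to p y -> G1 :* x = G1 :* y.
Proof.
move=> Gx Gy eqn eqp; apply/rcoset_eqP; rewrite mem_rcoset.
by apply: fix_np; rewrite ?groupM ?groupV // toK.
Qed.

Lemma pair_stabP g : g \in G ->
  reflect (to n g = n /\ to p g = p \/ to n g = p /\ to p g = n) (g \in G2).
Proof.
move=> Gg; apply: (iffP idP) => [/setIP[_ Ng]|fixg].
  have eqs : [set to n g; to p g] = [set n; p].
    by rewrite -[RHS](astabs_setact Ng) setactE imsetU1 imset_set1.
  exact: eq_set2 eqs.
rewrite inE Gg /= !inE (subsetP sGD) //=; apply/subsetP=> y; rewrite !inE.
by case: fixg => -[eqn eqp] /orP[]/eqP->; rewrite ?eqn ?eqp !eqxx ?orbT.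
Qed.

(** [G1] fixes [n], so any representative of the coset may be used. *)
Definition nuc (u : {set aT}) : rT := to n (repr u).

Lemma nucE x : x \in G -> nuc (G1 :* x) = to n x.
Proof.
move=> Gx; rewrite /nuc; have /rcosetP[g G1g ->] := mem_repr_rcoset G1 x.
by rewrite toM ?(G1G G1g) // fix_n.
Qed.

Lemma nuc_neighbour x g : x \in G -> g \in G1 -> nuc (G1 :* (t * (g * x))) = to p (g * x).
Proof. by move=> Gx /G1G Gg; rewrite nucE ?toM ?groupM // swap_n. Qed.

(** An element of [G2] either fixes [n] and [p], hence lies in [G1], or differs
from [t] by such an element. *)
Lemma ends_rcoset h : h \in G -> ends X (G2 :* h) = [set G1 :* h; G1 :* (t * h)].
Proof.
move=> Gh; apply/setP=> u; rewrite !inE; apply/andP/orP=> [[]|].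
  case/rcosetsP=> x Gx -> /set0Pn[y /setIP[/rcoset_eqP xy /rcosetP[g G2g eqy]]].
  have Gg : g \in G by case/setIP: G2g.
  rewrite -xy eqy; case/(pair_stabP Gg): G2g => -[eqn eqp].
    by left; apply/eqP/rcoset_fix_np; rewrite ?groupM // !toM ?eqn ?eqp.
  right; apply/eqP/rcoset_fix_np; rewrite ?groupM // !toM ?groupM //.
    by rewrite eqn swap_n.
  by rewrite eqp swap_p.
case=> /eqP->; split.
- by apply/rcosetsP; exists h.
- by apply/set0Pn; exists h; rewrite inE !rcoset_refl.
- by apply/rcosetsP; exists (t * h); rewrite ?groupM.
apply/set0Pn; exists (t * h); rewrite inE rcoset_refl /= mem_rcoset mulgK.
by apply/(pair_stabP Gt); right.
Qed.

Lemma nuc_ends h : h \in G -> nuc @: ends X (G2 :* h) = [set to n h; to p h].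
Proof.
move=> Gh; rewrite ends_rcoset // imsetU1 imset_set1 !nucE ?groupM //.
by rewrite toM // swap_n.
Qed.

Let neq_nph h : h \in G -> to n h != to p h.
Proof.
move=> Gh; apply: contraNneq neq_np => eqh.
apply/eqP; rewrite -[n](actKin to (subsetP sGD _ Gh)) eqh.
by rewrite actKin ?(subsetP sGD).
Qed.

(** The nuclei of the two ends of an edge are the two points of the edge, and an
unordered pair of points determines its coset of [G2]. *)
Lemma coset_graph_simple : simple_graph X.
Proof.
split=> [_ /rcosetsP[h Gh ->]|_ _ /rcosetsP[g Gg ->] /rcosetsP[h Gh ->] eqe].
  rewrite ends_rcoset // cards2; case: eqP => // /(congr1 nuc).
  by rewrite !nucE ?groupM // toM // swap_n => eqh; have := neq_nph Gh; rewrite eqh eqxx.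
have: [set to n g; to p g] = [set to n h; to p h] by rewrite -!nuc_ends ?eqe.
move/eq_set2=> eqgh; apply/rcoset_eqP; rewrite mem_rcoset.
have KV y : to (to y h) h^-1 = y by rewrite actKin ?(subsetP sGD).
apply/pair_stabP; rewrite ?groupM ?groupV // !toM ?groupV //.
by case: eqgh => -[-> ->]; rewrite !KV; [left|right].
Qed.

Lemma adjP u v : reflect (exists2 h, h \in G & u = G1 :* h /\ v = G1 :* (t * h))
                         (adj X u v).
Proof.
apply: (iffP existsP) => [[_ /andP[/rcosetsP[h Gh ->]]]|[h Gh [-> ->]]]; last first.
  exists (G2 :* h); rewrite ends_rcoset // eqxx andbT.
  by apply/rcosetsP; exists h.
rewrite ends_rcoset // => /eqP/eq_set2[] [<- <-]; first by exists h.
exists (t * h); rewrite ?groupM //; split=> //.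
by apply: rcoset_fix_np; rewrite ?groupM // !toM ?groupM // !(swap_n, swap_p).
Qed.

Lemma neighbours_cocircular u v w :
  adj X v u -> adj X v w -> cocircular (nuc v) (nuc u) (nuc w).
Proof.
case/adjP=> x Gx [-> ->] /adjP[y Gy [eqxy ->]].
have /rcosetP[h G1h eqy] : y \in G1 :* x by rewrite eqxy rcoset_refl.
exists x, h; split=> //; first by rewrite nucE.
  by rewrite nucE ?groupM // toM // swap_n.
by rewrite eqy nuc_neighbour.
Qed.

Lemma nuc_inj_neighbours u v w : adj X v u -> adj X v w -> nuc u = nuc w -> u = w.
Proof.
case/adjP=> x Gx [-> ->] /adjP[y Gy [eqxy ->]].
have eqn : to n x = to n y by rewrite -!nucE // eqxy.
rewrite !nucE ?groupM // !toM // swap_n => eqp.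
by apply: rcoset_fix_np; rewrite ?groupM // !toM // !(swap_n, swap_p).
Qed.

Section Girth.
Hypothesis no_triangle : forall a b r, cocircular a b r -> cocircular b a r -> False.
Hypothesis no_quadrangle : forall a b r s, cocircular a b s -> cocircular b a r ->
  cocircular r b s -> r <> a -> s = b.

(** In a quadrangle, opposite vertices have distinct nuclei because they have a
common neighbour; the conditions at three consecutive vertices then violate
[no_quadrangle]. *)
Lemma coset_graph_girth_ge5 k C : is_cycle X k C -> (5 <= k)%N.
Proof.
case/andP=> k_gt2 /existsP[s /and4P[_ Us Cs _]].
case: k k_gt2 s Us Cs => [|[|[|[|[|k]]]]] // _ [[|u0 [|u1 [|u2 [|u3 [|u4 s]]]]] //= _].
  move=> _ /and4P[a01 a12 a20 _].
  have := neighbours_cocircular a01; rewrite adj_sym in a20.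
  move=> /(_ _ a20); rewrite adj_sym in a01.
  by move/no_triangle=> /(_ (neighbours_cocircular a01 a12)).
rewrite !inE !negb_or !andbT => /and3P[/and3P[_ n02 _] /andP[_ n13] _].
case/and4P=> a01 a12 a23 a30.
have [a10 a21 a32 a03] : [/\ adj X u1 u0, adj X u2 u1, adj X u3 u2 & adj X u0 u3].
  by rewrite (adj_sym _ u0) (adj_sym _ u1) (adj_sym _ u2) (adj_sym _ u3).
case/eqP: n13; apply: (nuc_inj_neighbours a01 a03); symmetry.
apply: (no_quadrangle (neighbours_cocircular a01 a03)
          (neighbours_cocircular a10 a12) (neighbours_cocircular a21 a23)).
by move=> /(nuc_inj_neighbours a12 a10) eq20; rewrite eq20 eqxx in n02.
Qed.

End Girth.

(** The element [h * x] is another representative of the vertex of [x], chosen so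
that the base edge is carried exactly to the edge {m, m'}. *)
Lemma cocircular_adj m m' x y h : x \in G -> y \in G -> h \in G1 ->
    m = to n x -> m' = to p (h * x) -> m' = to n y -> m = to p y ->
  adj X (G1 :* x) (G1 :* y).
Proof.
move=> Gx Gy G1h mx m'x m'y my; have Gh := G1G G1h.
apply/adjP; exists (h * x); first by rewrite groupM.
split; last first.
  apply: rcoset_fix_np; rewrite ?groupM // !toM ?groupM // ?(swap_n, swap_p).
    by rewrite -m'y m'x toM.
  by rewrite fix_n // -mx.
by apply/rcoset_eqP; rewrite mem_rcoset invMg mulgA mulgV mul1g groupV.
Qed.

Lemma cocircular5_cycle m0 m1 m2 m3 m4 :
    uniq [:: m0; m1; m2; m3; m4] ->
    cocircular m0 m4 m1 -> cocircular m1 m0 m2 -> cocircular m2 m1 m3 ->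
    cocircular m3 m2 m4 -> cocircular m4 m3 m0 ->
  exists s : 5.-tuple {set aT},
    [/\ all [in verts X] s, uniq s, path.cycle (adj X) s &
      map nuc s = [:: m0; m1; m2; m3; m4]].
Proof.
move=> Um [x0 [h0 [Gx0 Gh0 e0 r0 s0]]] [x1 [h1 [Gx1 Gh1 e1 r1 s1]]].
move=> [x2 [h2 [Gx2 Gh2 e2 r2 s2]]] [x3 [h3 [Gx3 Gh3 e3 r3 s3]]].
move=> [x4 [h4 [Gx4 Gh4 e4 r4 s4]]].
exists [tuple of [:: G1 :* x0; G1 :* x1; G1 :* x2; G1 :* x3; G1 :* x4]].
have eqm : map nuc [:: G1 :* x0; G1 :* x1; G1 :* x2; G1 :* x3; G1 :* x4] =
           [:: m0; m1; m2; m3; m4].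
  by rewrite /= !nucE // -e0 -e1 -e2 -e3 -e4.
split=> //.
- apply/allP=> u; rewrite !inE => /or4P[| | |/orP[]] /eqP->;
    apply/rcosetsP; [exists x0 | exists x1 | exists x2 | exists x3 | exists x4]; by [].
- by move: Um; rewrite -eqm; apply: map_uniq.
- by rewrite /= andbT; apply/and5P; split;
    [ exact: (cocircular_adj Gx0 Gx1 Gh0 e0 s0 e1 r1)
    | exact: (cocircular_adj Gx1 Gx2 Gh1 e1 s1 e2 r2)
    | exact: (cocircular_adj Gx2 Gx3 Gh2 e2 s2 e3 r3)
    | exact: (cocircular_adj Gx3 Gx4 Gh3 e3 s3 e4 r4)
    | exact: (cocircular_adj Gx4 Gx0 Gh4 e4 s4 e0 r0) ].
Qed.

Let stab1E x : {in G, forall g, (g \in 'C[x | to]) = (to x g == x)}.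
Proof. by move=> g Gg; rewrite !inE (subsetP sGD) //= sub1set inE. Qed.

(** Edges at the base vertex correspond to cosets of [G1 :&: G2], which is the
stabiliser of [p] in [G1]. *)
Lemma coset_graph_regular : regular X #|orbit to G1 p|.
Proof.
move=> _ /rcosetsP[x Gx ->].
have -> : [set a in edges X | inc X (G1 :* x) a] =
          (fun b : {set aT} => b :* x) @: rcosets G2 G1.
  apply/setP=> a; rewrite inE; apply/andP/imsetP.
    case=> /rcosetsP[h Gh ->] /set0Pn[y /setIP[/rcosetP[g G1g ->] /rcoset_eqP<-]].
    exists (G2 :* g); last by rewrite rcosetM.
    by apply/rcosetsP; exists g.
  case=> _ /rcosetsP[g G1g ->] ->; rewrite -rcosetM; split.
    by apply/rcosetsP; exists (g * x); rewrite ?(groupM (G1G G1g)) //.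
  apply/set0Pn; exists (g * x); rewrite inE rcoset_refl andbT.
  by rewrite mem_rcoset mulgK.
rewrite card_imset; last exact: rcoset_inj.
rewrite card_orbit_in ?(subset_trans sG1G) // -[LHS]indexgI; congr #|_ : _|.
apply/setP=> g; rewrite in_setI [in RHS]in_setI; case G1g: (g \in G1) => //=.
have Gg := G1G G1g; rewrite stab1E //.
apply/(pair_stabP Gg)/eqP=> [|eqp]; last by left; rewrite fix_n.
by rewrite fix_n //; case=> -[] // eqnp; move: neq_np; rewrite eqnp eqxx.
Qed.

(** Both sides are the index in [G] of the pointwise stabiliser of [n] and [p],
computed through [G1] and through the stabiliser of [n]. *)
Lemma card_coset_graph :
  (#|verts X| * #|orbit to G1 p| = #|orbit to G n| * #|orbit to 'C_G[n | to] p|)%N.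
Proof.
have sG1C : G1 \subset 'C_G[n | to].
  by apply/subsetP=> g G1g; rewrite inE stab1E ?G1G //= fix_n.
rewrite !(@card_orbit_in _ _ _ to) ?(subset_trans sG1G) ?(subset_trans (subsetIl _ _)) //.
have eqC : 'C_G1[p | to] = 'C_('C_G[n | to])[p | to].
  apply/setP=> g; rewrite in_setI [in RHS]in_setI.
  apply/andP/andP=> -[Hg Cg]; split=> //; first exact: (subsetP sG1C).
  case/setIP: Hg => Gg; rewrite stab1E // in Cg *.
  by rewrite stab1E // => /eqP Cn; apply: fix_np => //; apply/eqP.
transitivity #|G : 'C_G1[p | to]|.
  by apply: Lagrange_index; rewrite ?subsetIl.
by rewrite eqC; symmetry; apply: Lagrange_index; rewrite ?subsetIl.
Qed.

Definition pentagon_at r r3 r4 : Prop :=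
  [/\ uniq [:: n; p; r; r3; r4], cocircular n r4 p, cocircular p n r,
      cocircular r p r3 & cocircular r3 r r4 /\ cocircular r4 r3 n].

(** Recovers from the edge set of a pentagon through the edge {n, p} the nucleus
that follows [p]; it serves to tell pentagons apart. *)
Definition follows_p (C : {set {set aT}}) : pred rT :=
  fun r => (r != n) && [exists a in C, nuc @: ends X a == [set p; r]].

Lemma pentagon_cycle r r3 r4 : pentagon_at r r3 r4 ->
  exists C, [/\ is_cycle X 5 C, gval G2 \in C & follows_p C =1 pred1 r].
Proof.
case=> Ur c0 c1 c2 [c3 c4].
have [s [Vs Us Cs]] := cocircular5_cycle Ur c0 c1 c2 c3 c4.
case: s Vs Us Cs => -[|u0 [|u1 [|u2 [|u3 [|u4 [|//]]]]]] // sz5 Vs Us Cs.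
case=> m0 m1 m2 m3 m4.
set s := [:: u0; u1; u2; u3; u4] in Us.
have [a01 a12] : adj X u0 u1 /\ adj X u1 u2 by case/and3P: Cs.
have nexts : [/\ next s u0 = u1, next s u1 = u2, next s u2 = u3,
                 next s u3 = u4 & next s u4 = u0].
  move: Us; rewrite /s /= !inE !negb_or ![u0 == _]eq_sym ![u1 == _]eq_sym.
  rewrite ![u2 == _]eq_sym ![u3 == _]eq_sym !eqxx.
  case/and5P=> /and4P[/negPf-> /negPf-> /negPf-> /negPf->].
  by case/and3P=> /negPf-> /negPf-> /negPf-> /andP[/negPf-> /negPf->] /negPf->.
have [n0 n1 n2 n3 n4] := nexts.
pose C := [set a in edges X | [exists x in s, ends X a == [set x; next s x]]].
exists C; split.
- by rewrite /is_cycle; apply/existsP; exists (Tuple sz5); apply/and4P.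
- have [h Gh [eqh eqth]] := elimT (adjP _ _) a01.
  have nh : to n h = n by rewrite -nucE // -eqh.
  have ph : to p h = p by rewrite -[RHS]m1 eqth nucE ?groupM // toM // swap_n.
  rewrite inE; apply/andP; split; first by apply/rcosetsP; exists 1; rewrite ?rcoset1.
  apply/existsP; exists u0; rewrite mem_head n0 eqh eqth -{1}[G2 : {set aT}]rcoset1.
  rewrite ends_rcoset //.
  have e1 : G1 :* 1 = G1 :* h by apply: rcoset_fix_np; rewrite ?act1.
  have et : G1 :* (t * 1) = G1 :* (t * h).
    by apply: rcoset_fix_np; rewrite ?groupM // !toM // ?act1 !(swap_n, swap_p).
  by rewrite e1 et eqxx.
have imset2 (x y : {set aT}) : nuc @: [set x; y] = [set nuc x; nuc y].
  by rewrite imsetU1 imset_set1.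
have [rn pr pr3 pr4] : [/\ r != n, p <> r, p <> r3 & p <> r4].
  move: Ur; rewrite /= !inE !negb_or [r == n]eq_sym => /and4P[/and4P[_ -> _ _]].
  by case/and3P=> /eqP ? /eqP ? /eqP.
have np := elimN eqP neq_np.
move=> r'; apply/andP/eqP=> [[/eqP r'n]|->].
  have memsE x : (x \in s) = [|| x == u0, x == u1, x == u2, x == u3 | x == u4].
    by rewrite /s !inE.
  case/existsP=> a /andP[]; rewrite /C inE => /andP[_ /existsP[x /andP[]]].
  rewrite memsE => /or4P[| | |/orP[]] /eqP-> /eqP->;
    rewrite imset2 (n0, n1, n2, n3, n4) ?(m0, m1, m2, m3, m4) => /eqP/eq_set2;
    intuition congruence.
split=> //; apply/existsP; case/existsP: a12 => a /andP[Ea /eqP eqa].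
exists a; rewrite eqa imset2 m1 m2 eqxx andbT inE Ea.
apply/existsP; exists u1; rewrite n1 eqa eqxx andbT.
by rewrite !inE eqxx orbT.
Qed.

(** Each element of [B] is the nucleus following [p] on some pentagon through the
base edge, and distinct elements give distinct pentagons. *)
Theorem nucleus_graph_egr (q : nat) (B : {set rT}) :
    (0 < q)%N -> (0 < #|B|)%N -> #|orbit to G n| = (q ^ 2 + 1)%N ->
    #|orbit to 'C_G[n | to] p| = (q ^ 2)%N -> #|orbit to G1 p| = q ->
    (forall a b r, cocircular a b r -> cocircular b a r -> False) ->
    (forall a b r s, cocircular a b s -> cocircular b a r ->
       cocircular r b s -> r <> a -> s = b) ->
    (forall r, r \in B -> exists r3 r4, pentagon_at r r3 r4) ->
  exists lambda, (#|B| <= lambda)%N /\ egr X (q * (q ^ 2 + 1)) q 5 lambda.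
Proof.
move=> q_gt0 B_gt0 oG oGn oG1 no3 no4 pentB.
pose cycles := [set C | is_cycle X 5 C & gval G2 \in C].
have EG2 : gval G2 \in edges X by apply/rcosetsP; exists 1; rewrite ?rcoset1.
exists #|cycles|; split.
  pose f C := odflt n [pick r | follows_p C r].
  have sBf : B \subset f @: cycles.
    apply/subsetP=> r /pentB[r3 [r4 /pentagon_cycle[C [cC G2C eqC]]]].
    apply/imsetP; exists C; first by rewrite inE cC.
    by rewrite /f (eq_pick eqC) /=; case: pickP => [s /eqP|/(_ r)/eqP].
  exact: leq_trans (subset_leq_card sBf) (leq_imset_card _ _).
split.
- exact: coset_graph_simple.
- apply/eqP; rewrite -(eqn_pmul2r q_gt0) -{1}oG1 card_coset_graph oG oGn.
  by apply/eqP; ring.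
- by move=> u Vu; rewrite coset_graph_regular.
- split; last exact: coset_graph_girth_ge5 no3 no4.
  case/card_gt0P: B_gt0 => r /pentB[r3 [r4 /pentagon_cycle[C [cC _ _]]]].
  by exists C.
by move=> a Ea; apply: card_cycles_coset_graph.
Qed.

End NucleusGraph.

Import GRing.Theory.
Local Open Scope ring_scope.

(** * Coordinates *)

Section RowVectors.
Variable F : finFieldType.
Implicit Types (a b c d z y x w : F).

Lemma rv4D z y x w a b c d :
  rv4 z y x w + rv4 a b c d = rv4 (z + a) (y + b) (x + c) (w + d).
Proof. by apply/rowP=> i; rewrite !mxE; case: i => -[|[|[|[|]]]]. Qed.

Lemma rv4Z k z y x w : k *: rv4 z y x w = rv4 (k * z) (k * y) (k * x) (k * w).
Proof. by apply/rowP=> i; rewrite !mxE; case: i => -[|[|[|[|]]]]. Qed.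

Lemma rv4_inj z y x w a b c d :
  rv4 z y x w = rv4 a b c d -> [/\ z = a, y = b, x = c & w = d].
Proof.
move=> eqv.
have E (i : 'I_4) : [:: z; y; x; w]`_i = [:: a; b; c; d]`_i.
  by have := congr1 (fun v : 'rV_4 => v 0 i) eqv; rewrite !mxE.
by split; [have := E 0 | have := E 1 | have := E 2%:R | have := E 3%:R].
Qed.

Lemma rv4E (v : 'rV[F]_4) : v = rv4 (v 0 0) (v 0 1) (v 0 2%:R) (v 0 3%:R).
Proof.
apply/rowP=> i; rewrite mxE; case: i => -[|[|[|[|]]]] // lti /=; congr (v _ _);
  exact: val_inj.
Qed.

Lemma rv4_mx4 z y x w m00 m01 m02 m03 m10 m11 m12 m13 m20 m21 m22 m23
    m30 m31 m32 m33 :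
  rv4 z y x w *m mx4 [:: [:: m00; m01; m02; m03]; [:: m10; m11; m12; m13];
                         [:: m20; m21; m22; m23]; [:: m30; m31; m32; m33]] =
  rv4 (z * m00 + y * m10 + x * m20 + w * m30)
      (z * m01 + y * m11 + x * m21 + w * m31)
      (z * m02 + y * m12 + x * m22 + w * m32)
      (z * m03 + y * m13 + x * m23 + w * m33).
Proof.
apply/rowP=> i; rewrite !mxE !big_ord_recl big_ord0 !mxE.
by case: i => -[|[|[|[|]]]] //= _; rewrite addr0 !addrA.
Qed.

Lemma rv4_diag z y x w a b c d :
  rv4 z y x w *m diag_mx (rv4 a b c d) = rv4 (z * a) (y * b) (x * c) (w * d).
Proof.
by apply/rowP=> i; rewrite mul_mx_diag !mxE; case: i => -[|[|[|[|]]]].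
Qed.

Definition cv4 a b c d : 'cV[F]_4 := (rv4 a b c d)^T.

Lemma rv4_cv4_eq0 z y x w a b c d :
  (rv4 z y x w *m cv4 a b c d == 0) = (z * a + y * b + x * c + w * d == 0).
Proof.
have -> : rv4 z y x w *m cv4 a b c d = (z * a + y * b + x * c + w * d)%:M.
  apply/matrixP=> i j; rewrite !ord1 !mxE !big_ord_recl big_ord0 !mxE /=.
  by rewrite addr0 !addrA mulr1n.
by apply/eqP/eqP=> [/matrixP/(_ 0 0)|->]; rewrite ?mxE ?raddf0.
Qed.

End RowVectors.

(** * The ovoid, its spread, and the generators of the Suzuki group *)

Section SuzukiTits.
Variables (F : finFieldType) (e : nat).
Hypothesis cardF : #|F| = (2 ^ (2 * e + 1))%N.
Local Notation t := (theta e : F -> F).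
Implicit Types (a b c d l x y z : F).

Let pchar2 : 2%N \in [pchar F]. Proof. exact: card_finPcharP cardF _. Qed.
Let two0 : 2%:R = 0 :> F. Proof. exact: pcharf0. Qed.

Lemma char2_eq (u v k : F) : u = v + 2%:R * k -> u = v.
Proof. by rewrite two0 mul0r addr0. Qed.

Lemma theta0 : t 0 = 0. Proof. by rewrite /theta expr0n expn_eq0. Qed.
Lemma theta1 : t 1 = 1. Proof. exact: expr1n. Qed.
Lemma thetaM x y : t (x * y) = t x * t y. Proof. exact: exprMn. Qed.
Lemma thetaV x : t x^-1 = (t x)^-1. Proof. exact: exprVn. Qed.
Lemma thetaD x y : t (x + y) = t x + t y.
Proof.
by rewrite /theta exprDn_pchar // (eq_pnat _ (pcharf_eq pchar2)) pnatX pnat_id.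
Qed.

Lemma theta_theta x : t (t x) = x ^+ 2.
Proof.
rewrite /theta -exprM -expnD (_ : (e.+1 + e.+1 = 2 * e + 1 + 1)%N); last first.
  by rewrite mul2n -addnn !addn1 addnS addSn.
by rewrite expnD exprM -cardF expf_card.
Qed.

Lemma theta_eq0 x : (t x == 0) = (x == 0).
Proof. by rewrite /theta expf_eq0 expn_gt0. Qed.

Definition pnorm x y := x * y + x ^+ 2 * t x + t y.

Lemma pnorm_theta x y : t (pnorm x y) = t x * t y + (x * t x + y) ^+ 2.
Proof. rewrite /pnorm !thetaD !thetaM !theta_theta. ring: two0. Qed.

(** If x <> 0, then u = y / (x theta x) satisfies theta u = u + 1.  Applying theta
again gives u^2 = u, so u is 0 or 1 and theta u = u, a contradiction. *)
Lemma pnorm_eq0 x y : pnorm x y = 0 -> x = 0 /\ y = 0.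
Proof.
have [-> | x0 N0] := eqVneq x 0.
  by rewrite /pnorm theta0 mulr0 mul0r !add0r => /eqP; rewrite theta_eq0 => /eqP.
pose u := y / (x * t x).
have tx0 : t x != 0 by rewrite theta_eq0.
have tu : t u = u + 1.
  rewrite /u thetaM thetaV thetaM theta_theta.
  apply/eqP; rewrite -subr_eq0; apply/eqP.
  have -> : t y = - (x * y + x ^+ 2 * t x).
    by apply/eqP; rewrite -addr_eq0 addrC; apply/eqP.
  transitivity (- (2%:R * (1 + y / (x * t x)))); last by rewrite two0 mul0r oppr0.
  by field; rewrite x0 tx0.
have := theta_theta u; rewrite tu thetaD theta1 tu => /eqP.
rewrite -addrA -mulr2n two0 addr0 eq_sym -subr_eq0 => /eqP u2.
have: u * (u - 1) = 0 by rewrite -u2; ring.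
move/eqP; rewrite mulf_eq0 subr_eq0 => /orP[] /eqP eu; move: tu; rewrite eu.
  by rewrite theta0 add0r => /esym/eqP; rewrite oner_eq0.
by rewrite theta1 => /eqP; rewrite -subr_eq0 opprD addrA subrr sub0r oppr_eq0 oner_eq0.
Qed.

Definition pvec (m : option (F * F)) : 'rV[F]_4 :=
  if m is Some (x, y) then rv4 (pnorm x y) y x 1 else rv4 1 0 0 0.
(** A second point of the spread line at the ovoid point: the third row of
Suzuki's matrix, as [pvec] is its fourth row. *)
Definition qvec (m : option (F * F)) : 'rV[F]_4 :=
  if m is Some (x, y) then rv4 (y + x * t x) (t x) 1 0 else rv4 0 1 0 0.

(** The matrix [g] carries the point and the spread line of [m] to those of [m'].
The scalars are kept so that compositions are plain linear algebra. *)
Definition moves (g : 'M[F]_4) (m m' : option (F * F)) : Prop :=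
  exists c d k, [/\ c != 0, pvec m *m g = c *: pvec m'
                  & qvec m *m g = d *: qvec m' + k *: pvec m'].

Lemma moves_mul g h m m' m'' : moves g m m' -> moves h m' m'' -> moves (g *m h) m m''.
Proof.
move=> [c [d [k [c0 Ep Eq]]]] [c' [d' [k' [c'0 Ep' Eq']]]].
exists (c * c'), (d * d'), (d * k' + k * c'); split; first by rewrite mulf_neq0.
  by rewrite mulmxA Ep -scalemxAl Ep' scalerA.
rewrite mulmxA Eq mulmxDl -!scalemxAl Ep' Eq' scalerDr !scalerA scalerDl.
by rewrite addrA.
Qed.

Lemma moves_suzukiS a b x y :
  moves (suzukiS e a b) (Some (x, y)) (Some (x + a, y + x * t a + a * t a + b)).
Proof.
exists 1, 1, 0; rewrite oner_neq0 !scale1r scale0r addr0 /=.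
rewrite /suzukiS /= !rv4_mx4 /pnorm !thetaD !thetaM !theta_theta.
split=> //; congr rv4; try by ring: two0.
symmetry; apply: (char2_eq (k := x ^+ 2 * t a + x * a * t a + a ^+ 2 * t a +
                                 a ^+ 2 * t x + x * a * (t x + t a))).
ring.
Qed.

Lemma moves_suzukiS_inf a b : moves (suzukiS e a b) None None.
Proof.
exists 1, 1, a; rewrite oner_neq0 !scale1r /= /suzukiS /= !rv4_mx4 rv4Z rv4D.
by split=> //; congr rv4; ring.
Qed.

Lemma theta_root l : t (l ^+ (2 ^ e)) = l.
Proof.
rewrite /theta -exprM -expnD (_ : (e + e.+1 = 2 * e + 1)%N) -?cardF ?expf_card //.
by rewrite mul2n -addnn addn1 addnS.
Qed.

Lemma moves_suzukiM l x y : l != 0 ->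
  moves (suzukiM e l) (Some (x, y)) (Some (l * x, l * t l * y)).
Proof.
move=> l0; set m := l ^+ (2 ^ e).
have tm : t m = l := theta_root l.
have m0 : m != 0 by rewrite expf_neq0.
have m2 : t l = m ^+ 2 by rewrite -theta_theta tm.
exists (l * m)^-1, m^-1, 0; rewrite invr_eq0 mulf_neq0 // scale0r addr0.
rewrite /suzukiM /= exprD expr1 -/m !rv4_diag !rv4Z /pnorm !thetaM !theta_theta m2.
by split=> //; congr rv4; field; rewrite ?l0 ?m0.
Qed.

Lemma moves_suzukiM_inf l : l != 0 -> moves (suzukiM e l) None None.
Proof.
move=> l0; exists (l ^+ (1 + 2 ^ e)), (l ^+ (2 ^ e)), 0.
rewrite expf_neq0 // scale0r addr0 /suzukiM /= !rv4_diag !rv4Z.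
by split=> //; congr rv4; ring.
Qed.

Lemma moves_suzukiT_inf : moves (suzukiT F) None (Some (0, 0)).
Proof.
exists 1, 1, 0; rewrite oner_neq0 !scale1r scale0r addr0 /= /suzukiT /=.
by rewrite !rv4_mx4 /pnorm theta0; split=> //; congr rv4; ring.
Qed.

(** With z, w, u, v for the norm of (x, y), its theta, theta x and theta y, the four
equations below are all that remains after clearing denominators. *)
Lemma moves_suzukiT x y : pnorm x y != 0 ->
  moves (suzukiT F) (Some (x, y)) (Some (y / pnorm x y, x / pnorm x y)).
Proof.
move=> z0; set z := pnorm x y in z0 *.
have tz : t z = t x * t y + (x * t x + y) ^+ 2 := pnorm_theta x y.
have tz0 : t z != 0 by rewrite theta_eq0.
have zE : z = x * y + x ^+ 2 * t x + t y by [].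
exists z, (t z / z), (y + x * t x); rewrite z0 /= -/z /pnorm !thetaM !thetaV.
clearbody z; move: tz zE tz0; move: (t z) (t x) (t y) => w u v wE zE w0.
have norm1 : x * y * w + y ^+ 2 * v + z ^+ 2 * u = z * w by rewrite wE zE; ring.
have k1 : x * w + y * v + z * (y + x * u) = 0.
  apply: (char2_eq (k := x * u * v + x ^+ 3 * u ^+ 2 + x ^+ 2 * u * y *+ 2 +
                         x * y ^+ 2 + y * v)).
  by rewrite wE zE; ring.
have k2 : v + (y + x * u) * x = z by rewrite zE; ring.
have k3 : w + (y + x * u) * y = u * z.
  by apply: (char2_eq (k := x * u * y + y ^+ 2)); rewrite wE zE; ring.
have norm' : y / z * (x / z) + (y / z) ^+ 2 * (v / w) + u / w = z^-1.
  transitivity ((x * y * w + y ^+ 2 * v + z ^+ 2 * u) / (z ^+ 2 * w)).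
    by field; rewrite z0 w0.
  by rewrite norm1; field; rewrite z0 w0.
rewrite /suzukiT !rv4_mx4 !rv4Z rv4D norm' mulfV //.
split=> //; first by congr rv4; field.
congr rv4; last by ring.
- transitivity ((x * w + y * v + z * (y + x * u)) / z ^+ 2); first by rewrite k1; ring.
  by field; rewrite z0 w0.
- transitivity ((v + (y + x * u) * x) / z); first by rewrite k2; field.
  by field; rewrite z0 w0.
transitivity ((w + (y + x * u) * y) / z); first by rewrite k3; field.
by field.
Qed.
End SuzukiTits.

Lemma PG3act_rowg (F : finFieldType) m (A : 'M[F]_(m, 4)) (g : {'GL_4[F]}) :
  PG3act F (rowg A) g = rowg (A *m GLval g).
Proof.
have Ug : GLval g \in unitmx := GL_unit g.
rewrite /PG3act /= /setact; apply/setP=> u; rewrite [RHS]mem_rowg.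
apply/imsetP/idP=> [[v]|uAg].
  by rewrite mem_rowg /= mx_repr_actE ?inE // => vA ->; apply: submxMr.
exists (u *m invmx (GLval g)); last by rewrite /= mx_repr_actE ?inE //= mulmxKV.
by rewrite mem_rowg -[A](mulmxK Ug); apply: submxMr.
Qed.

(** * The action on the ovoid *)

Section SuzukiAction.
Variables (F : finFieldType) (e : nat).
Hypothesis cardF : #|F| = (2 ^ (2 * e + 1))%N.
Local Notation t := (theta e : F -> F).
Local Notation G := (Sz F e).
Implicit Types (l x y z : F) (m r s : option (F * F)).

Let GL_of_unitmx (A : 'M[F]_4) : A \in unitmx -> exists g : {'GL_4[F]}, GLval g = A.
Proof. by move=> uA; exists (FinRing.unit 'M[F]_4 uA). Qed.

Lemma Sz_S (a b : F) : exists2 g, g \in G & GLval g = suzukiS e a b.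
Proof.
have [|g eqg] := @GL_of_unitmx (suzukiS e a b).
  rewrite unitmxE det_trig ?big_ord_recl ?big_ord0 ?mxE ?mulr1 ?unitr1 //.
  apply/is_trig_mxP=> -[i lti] [j ltj]; rewrite !mxE /=.
  by case: i lti => [|[|[|[|]]]] //; case: j ltj => [|[|[|[|]]]].
exists g => //; apply: mem_gen; rewrite inE; apply/or3P/Or31.
by apply/existsP; exists a; apply/existsP; exists b; apply/eqP.
Qed.

Lemma Sz_M l : l != 0 -> exists2 g, g \in G & GLval g = suzukiM e l.
Proof.
move=> l0; have [|g eqg] := @GL_of_unitmx (suzukiM e l).
  rewrite unitmxE det_diag unitfE !big_ord_recl big_ord0 !mxE /=.
  by rewrite !mulf_neq0 ?invr_eq0 ?expf_neq0 ?oner_neq0.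
exists g => //; apply: mem_gen; rewrite inE; apply/or3P/Or32.
by apply/existsP; exists l; rewrite l0; apply/eqP.
Qed.

Lemma suzukiT_involution : suzukiT F *m suzukiT F = 1%:M.
Proof.
apply/row_matrixP=> i; rewrite !rowE mulmxA mulmx1 (rv4E (delta_mx _ _)).
by rewrite !rv4_mx4; congr rv4; ring.
Qed.

Lemma Sz_T : exists2 g, g \in G & GLval g = suzukiT F.
Proof.
have [|g eqg] := @GL_of_unitmx (suzukiT F).
  by have [] := mulmx1_unit suzukiT_involution.
exists g => //; apply: mem_gen; rewrite inE; apply/or3P/Or33; exact/eqP.
Qed.

(** By induction on a word in the generators.  Only the inversion at an affine point
needs a distinction: the origin goes to infinity, and elsewhere the norm is
nonzero by [pnorm_eq0]. *)
Lemma Sz_moves g m : g \in G -> exists m', moves e (GLval g) m m'.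
Proof.
case/gen_prodgP=> k [c genc ->]; elim: k c genc m => [|k IHk] c genc m.
  rewrite big_ord0; exists m; exists 1, 1, 0.
  by rewrite oner_neq0 !mulmx1 !scale1r scale0r addr0.
rewrite big_ord_recr GL_MxE.
have [m' mm'] := IHk _ (fun i => genc (widen_ord (leqnSn k) i)) m.
suff [m'' mm''] : exists m'', moves e (GLval (c ord_max)) m' m''.
  by exists m''; apply: moves_mul mm' mm''.
have := genc ord_max; rewrite inE => /or3P[].
- case/existsP=> a /existsP[b /eqP->]; case: m' mm' => [[x y]|] _.
    by eexists; apply: moves_suzukiS.
  by eexists; apply: moves_suzukiS_inf.
- case/existsP=> l /andP[l0 /eqP->]; case: m' mm' => [[x y]|] _.
    by eexists; apply: moves_suzukiM.
  by eexists; apply: moves_suzukiM_inf.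
move/eqP->; case: m' mm' => [[x y]|] _; last by eexists; apply: moves_suzukiT_inf.
have [/(pnorm_eq0 cardF)[-> ->] | z0] := eqVneq (pnorm e x y) 0; last first.
  by eexists; apply: moves_suzukiT.
exists None; exists 1, 1, 0; rewrite oner_neq0 !scale1r scale0r addr0 /=.
by rewrite /suzukiT !rv4_mx4 /pnorm theta0; split=> //; congr rv4; ring.
Qed.

Definition pt m : {set 'rV[F]_4} := rowg (pvec e m).

Lemma pvec_scale_inj (c : F) m m' : pvec e m = c *: pvec e m' -> m = m'.
Proof.
case: m m' => [[x y]|] [[x' y']|] //=; rewrite rv4Z => /rv4_inj[].
- by move=> _ -> ->; rewrite mulr1 => <-; rewrite !mul1r.
- by move=> _ _ _ /eqP; rewrite mulr0 oner_eq0.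
by move=> + _ _; rewrite mulr1 => + c0; rewrite -c0 mul0r => /eqP; rewrite oner_eq0.
Qed.

Lemma pt_inj : injective pt.
Proof.
move=> m m' eqpt; have: pvec e m \in pt m' by rewrite -eqpt mem_rowg.
by rewrite mem_rowg => /sub_rVP[c]; apply: pvec_scale_inj.
Qed.

(** The action transported to coordinates; the default value is never taken when
[g] lies in the Suzuki group. *)
Definition ptmap (g : {'GL_4[F]}) m : option (F * F) :=
  odflt m [pick m' | pt m' == PG3act F (pt m) g].

Lemma moves_pt (g : {'GL_4[F]}) m m' :
  moves e (GLval g) m m' -> PG3act F (pt m) g = pt m'.
Proof.
case=> c [d [k [c0 Ep _]]]; rewrite PG3act_rowg Ep.
exact/eq_rowg/eqmx_scale.
Qed.

Lemma moves_ptmap (g : {'GL_4[F]}) m m' : moves e (GLval g) m m' -> ptmap g m = m'.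
Proof.
move/moves_pt; rewrite /ptmap => ->; case: pickP => [m'' /eqP/pt_inj //|/(_ m')].
by rewrite eqxx.
Qed.

Lemma ptmap_moves g m : g \in G -> moves e (GLval g) m (ptmap g m).
Proof. by case/(Sz_moves m) => m' mm'; rewrite (moves_ptmap mm'). Qed.

Lemma pt_ptmap g m : g \in G -> pt (ptmap g m) = PG3act F (pt m) g.
Proof. by move=> Gg; apply/esym/moves_pt/ptmap_moves. Qed.

Lemma ptmapM m : {in G &, forall g h, ptmap (g * h) m = ptmap h (ptmap g m)}.
Proof.
move=> g h Gg Gh; apply: moves_ptmap; rewrite GL_MxE.
by apply: moves_mul; apply: ptmap_moves.
Qed.

Lemma ptmap1 m : ptmap 1 m = m.
Proof. by apply: pt_inj; rewrite pt_ptmap ?group1 // act1. Qed.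

Lemma ptmapK g : g \in G -> cancel (ptmap g) (ptmap g^-1).
Proof. by move=> Gg m; rewrite -ptmapM ?groupV // mulgV ptmap1. Qed.

Lemma ptmapVK g : g \in G -> cancel (ptmap g^-1) (ptmap g).
Proof. by move=> Gg m; rewrite -ptmapM ?groupV // mulVg ptmap1. Qed.

Lemma ptmap_inj g : g \in G -> injective (ptmap g).
Proof. by move/ptmapK/can_inj. Qed.

Local Notation o := (Some (0, 0) : option (F * F)).

(** Suzuki's matrix S(a, b) translates by (a, a theta a + b), whence the shifted
second parameter. *)
Lemma Sz_translation (a b : F) : exists g, [/\ g \in G, ptmap g None = None &
  forall x y, ptmap g (Some (x, y)) = Some (x + a, y + x * t a + b)].
Proof.
have [g Gg eqg] := Sz_S a (b - a * t a).
exists g; split=> // [|x y]; apply: moves_ptmap; rewrite eqg.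
  exact: moves_suzukiS_inf.
rewrite (_ : _ + b = y + x * t a + a * t a + (b - a * t a)); last by ring.
exact: moves_suzukiS.
Qed.

Lemma Sz_torus l : l != 0 -> exists g, [/\ g \in G, ptmap g None = None &
  forall x y, ptmap g (Some (x, y)) = Some (l * x, l * t l * y)].
Proof.
move=> l0; have [g Gg eqg] := Sz_M l0.
exists g; split=> // [|x y]; apply: moves_ptmap; rewrite eqg.
  exact: moves_suzukiM_inf.
exact: moves_suzukiM.
Qed.

Lemma Sz_inversion : exists g, [/\ g \in G, ptmap g None = o & ptmap g o = None].
Proof.
have [g Gg eqg] := Sz_T.
have gN : ptmap g None = o by apply: moves_ptmap; rewrite eqg; apply: moves_suzukiT_inf.
exists g; split=> //; rewrite -gN -ptmapM //.
suff -> : (g * g = 1)%g by rewrite ptmap1.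
by apply: val_inj; change (GLval g *m GLval g = 1%:M); rewrite eqg suzukiT_involution.
Qed.

Lemma Sz_trans_None m : exists2 g, g \in G & ptmap g m = None.
Proof.
case: m => [[x y]|]; last by exists 1%g; rewrite ?ptmap1.
have [g [Gg gN gE]] := Sz_translation x y.
have [h [Gh hN ho]] := Sz_inversion.
exists (g^-1 * h)%g; first by rewrite groupM ?groupV.
have <- : ptmap g o = Some (x, y) by rewrite gE mul0r !add0r.
by rewrite ptmapM ?groupV // ptmapK.
Qed.

(** The inversion exchanges inf and the origin, and the translations, which fix inf,
are transitive on the affine points. *)
Lemma Sz_2trans m r : m != r ->
  exists g, [/\ g \in G, ptmap g None = m & ptmap g o = r].
Proof.
move=> neq_mr; have [g Gg gm] := Sz_trans_None m.
case eqr: (ptmap g r) => [[x y]|]; last first.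
  by rewrite -gm in eqr; rewrite (ptmap_inj Gg eqr) eqxx in neq_mr.
have [h [Gh hN hE]] := Sz_translation x y.
have eqo : ptmap h o = ptmap g r by rewrite hE eqr mul0r !add0r.
exists (h * g^-1)%g; split; first by rewrite groupM ?groupV.
  by rewrite ptmapM ?groupV // hN -gm ptmapK.
by rewrite ptmapM ?groupV // eqo ptmapK.
Qed.

Lemma Sz_2trans_pairs a b m r : a != b -> m != r ->
  exists g, [/\ g \in G, ptmap g a = m & ptmap g b = r].
Proof.
case/Sz_2trans=> g [Gg <- <-] /Sz_2trans[h [Gh <- <-]].
by exists (g^-1 * h)%g; rewrite groupM ?groupV // !ptmapM ?groupV // !ptmapK.
Qed.

(** The plane through [s] contains the spread line of [m] and [r]: [r] and [s] lie
on a common circle with nucleus [m].  The conditions on [r] and [s] exclude the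
nucleus, for which the plane would not be determined. *)
Definition coplanar m r s : bool :=
  [&& r != m, s != m & [exists k : F * F * F,
    pvec e s == k.1.1 *: pvec e m + k.1.2 *: qvec e m + k.2 *: pvec e r]].

Lemma coplanarP m r s : reflect
  [/\ r != m, s != m & exists a b c,
     pvec e s = a *: pvec e m + b *: qvec e m + c *: pvec e r] (coplanar m r s).
Proof.
apply: (iffP and3P) => -[rm sm H]; split=> //.
  by case/existsP: H => -[[a b] c] /eqP; exists a, b, c.
by case: H => a [b [c Es]]; apply/existsP; exists (a, b, c); apply/eqP.
Qed.

Lemma coplanar_ptmap_imp g m r s : g \in G ->
  coplanar m r s -> coplanar (ptmap g m) (ptmap g r) (ptmap g s).
Proof.
move=> Gg /coplanarP[rm sm [a [b [c Es]]]]; apply/coplanarP.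
rewrite !(inj_eq (ptmap_inj Gg)); split=> //.
have [cm [d [k [_ Em Eq]]]] := ptmap_moves m Gg.
have [cr [_ [_ [_ Er _]]]] := ptmap_moves r Gg.
have [cs [_ [_ [cs0 Es' _]]]] := ptmap_moves s Gg.
exists (cs^-1 * (a * cm + b * k)), (cs^-1 * (b * d)), (cs^-1 * (c * cr)).
apply: (scalerI cs0); rewrite -Es' Es !mulmxDl -!scalemxAl Em Eq Er.
rewrite !scalerDr !scalerA !mulrA divff // !mul1r scalerDl.
by rewrite -!addrA; congr (_ + _); rewrite addrCA.
Qed.

Lemma coplanar_ptmap g m r s : g \in G ->
  coplanar (ptmap g m) (ptmap g r) (ptmap g s) = coplanar m r s.
Proof.
move=> Gg; apply/idP/idP; last exact: coplanar_ptmap_imp.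
by move/(coplanar_ptmap_imp (groupVr Gg)); rewrite !ptmapK.
Qed.

Lemma coplanar_None x y s :
  coplanar None (Some (x, y)) s = (if s is Some (x', _) then x' == x else false).
Proof.
apply/coplanarP/idP=> [[_]|]; case: s => [[x' y']|] //.
  move=> _ [a [b [c]]] /=; rewrite !rv4Z !rv4D => /rv4_inj[_ _ -> E].
  by move: E; rewrite !mulr0 !mulr1 !add0r => <-; rewrite mul1r.
move=> /eqP->; split=> //.
exists (pnorm e x y' - pnorm e x y), (y' - y), 1.
by rewrite /= !rv4Z !rv4D; congr rv4; ring.
Qed.

Lemma coplanar_o_None x y : coplanar o None (Some (x, y)) -> y = 0.
Proof.
case/coplanarP=> _ _ [a [b [c]]].
by rewrite /= !rv4Z !rv4D theta0 => /rv4_inj[_ -> _ _]; ring.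
Qed.

End SuzukiAction.

(** * Circles and their nuclei *)

Section Circles.
Variables (F : finFieldType) (e : nat).
Hypothesis cardF : #|F| = (2 ^ (2 * e + 1))%N.
Local Notation t := (theta e : F -> F).
Local Notation G := (Sz F e).
Local Notation ptmap := (ptmap e).
Local Notation coplanar := (coplanar e).
Local Notation o := (Some (0, 0) : option (F * F)).
Implicit Types (x y : F) (a b d m r s : option (F * F)).

Let two0 : 2%:R = 0 :> F.
Proof. exact/pcharf0/(card_finPcharP cardF). Qed.

(** Double transitivity packaged as a change of coordinates: [a] becomes the point
at infinity and [b] the origin. *)
Variant base_spec a b : Prop :=
  BaseSpec g of g \in G & a = ptmap g None & b = ptmap g o &
    (forall s, exists s', s = ptmap g s').

Lemma baseP a b : a != b -> base_spec a b.
Proof.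
case/(Sz_2trans cardF)=> g [Gg ga gb]; exists g => // s.
by exists (ptmap g^-1 s); rewrite ptmapVK.
Qed.

Lemma coplanar_neq a b s : coplanar a b s -> a != b.
Proof. by case/coplanarP=> ba _ _; rewrite eq_sym. Qed.

Lemma coplanar_refl a b : a != b -> coplanar a b b.
Proof.
move=> ab; apply/coplanarP; rewrite eq_sym ab; split=> //.
by exists 0, 0, 1; rewrite !scale0r !add0r scale1r.
Qed.

Lemma coplanar_class a b c s : coplanar a b c -> coplanar a c s = coplanar a b s.
Proof.
move=> abc; move: (abc); have [g Gg -> -> img] := baseP (coplanar_neq abc).
have [c' ->] := img c; have [s' ->] := img s.
rewrite !coplanar_ptmap // coplanar_None.
by case: c' => [[x y]|] // /eqP->; rewrite !coplanar_None.
Qed.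

Lemma coplanar_no_triangle a b r : coplanar a b r -> coplanar b a r -> False.
Proof.
move=> abr; move: (abr); have [g Gg -> -> img] := baseP (coplanar_neq abr).
have [r' ->] := img r; rewrite !coplanar_ptmap // coplanar_None.
case: r' => [[x y]|] // /eqP-> /[dup] /coplanar_o_None->.
by case/coplanarP=> _ /eqP.
Qed.

(** With [a] at infinity and [b] the origin, [s] is (0, v) and [r] is (x, 0).  On the
plane of the last circle the first coordinate plus x theta x times the third one
vanishes, and its value at [s] is theta v. *)
Lemma coplanar_no_quadrangle a b r s :
  coplanar a b s -> coplanar b a r -> coplanar r b s -> r <> a -> s = b.
Proof.
move=> abs; move: (abs); have [g Gg -> -> img] := baseP (coplanar_neq abs).
have [r' ->] := img r; have [s' ->] := img s.
rewrite !coplanar_ptmap // coplanar_None; case: s' => [[x v]|] // /eqP->.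
case: r' => [[x' y]|] // /coplanar_o_None-> /coplanarP[_ _ [k1 [k2 [k3]]]].
rewrite /= !rv4Z !rv4D /pnorm !(theta0, mulr0, mul0r, addr0, add0r, expr0n).
case/rv4_inj=> E _ E2 _ _; suff : t v = 0 by move/eqP; rewrite theta_eq0 => /eqP->.
transitivity (x' * t x' * (k1 * x' + k2 * 1)); last by rewrite -E2 mulr0.
by rewrite E; ring.
Qed.

Lemma card_coplanar_class a b : a != b -> #|[set s | coplanar a b s]| = #|F|.
Proof.
case/baseP=> g Gg -> -> img.
have inj : injective (fun v : F => ptmap g (Some (0, v))).
  by move=> u v /(ptmap_inj cardF Gg)[].
rewrite -(card_imset _ inj); apply: eq_card => s; rewrite inE.
have [s' ->] := img s; rewrite coplanar_ptmap // coplanar_None; apply/idP/imsetP.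
  by case: s' => [[x y]|] // /eqP->; exists y.
by case=> v _ /(ptmap_inj cardF Gg)->.
Qed.

(** For nucleus at infinity and [d] the origin this is a translation along the
second coordinate; it preserves every circle with nucleus [a]. *)
Lemma elation a d s : coplanar a d s -> exists2 g, g \in G &
  [/\ ptmap g a = a, ptmap g d = s & forall u, u != a -> coplanar a u (ptmap g u)].
Proof.
move=> ads; have [h Gh ha hd img] := baseP (coplanar_neq ads).
move: ads; rewrite ha hd; have [s' ->] := img s.
rewrite coplanar_ptmap // coplanar_None; case: s' => [[x v]|] // /eqP->.
have [g [Gg gN gE]] := Sz_translation cardF 0 v.
have gM u : ptmap (h^-1 * (g * h))%g (ptmap h u) = ptmap h (ptmap g u).
  by rewrite !ptmapM ?groupM ?groupV // ptmapK.
exists (h^-1 * (g * h))%g; first by rewrite !groupM ?groupV.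
split; rewrite ?gM ?gN ?gE ?addr0 ?mul0r ?add0r // => u.
have [u' ->] := img u; rewrite gM coplanar_ptmap // (inj_eq (ptmap_inj cardF Gh)).
by case: u' => [[x' y]|] // _; rewrite gE coplanar_None addr0.
Qed.

(** For [a] at infinity and [b] the origin this is an element of the torus, with a
parameter different from 0 and 1. *)
Lemma homology a b d : (2 < #|F|)%N -> a != b -> d != a -> ~~ coplanar a b d ->
  exists2 g, g \in G & [/\ ptmap g a = a, ptmap g b = b & ~~ coplanar a d (ptmap g d)].
Proof.
move=> F_gt2 /baseP[h Gh -> -> img]; have [d' ->] := img d.
rewrite (inj_eq (ptmap_inj cardF Gh)) coplanar_ptmap //; case: d' => [[x y]|] // _.
rewrite coplanar_None => x0.
have [l l0 l1] : exists2 l : F, l != 0 & l != 1.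
  have : (0 < #|~: [set (0%R : F); 1%R]|)%N.
    by rewrite cardsCs setCK subn_gt0 cards2 eq_sym oner_eq0.
  by case/card_gt0P=> l; rewrite !inE negb_or => /andP[]; exists l.
have [g [Gg gN gE]] := Sz_torus cardF l0.
have gM u : ptmap (h^-1 * (g * h))%g (ptmap h u) = ptmap h (ptmap g u).
  by rewrite !ptmapM ?groupM ?groupV // ptmapK.
exists (h^-1 * (g * h))%g; first by rewrite !groupM ?groupV.
split; rewrite ?gM ?gN ?gE ?mulr0 // coplanar_ptmap // coplanar_None.
by apply: contra l1 => /eqP lx; rewrite -(inj_eq (mulIf x0)) lx mul1r.
Qed.

(** Equality in characteristic 2 of expressions whose constant terms differ by a
small even number. *)
Local Ltac mod2 := first [ring: two0 | apply: (char2_eq cardF (k := 1)); ring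
  | apply: (char2_eq cardF (k := -1)); ring | apply: (char2_eq cardF (k := 2%:R)); ring
  | apply: (char2_eq cardF (k := - 2%:R)); ring ].

(** The five points with coordinates in the field with two elements, in the cyclic
order inf, (0, 0), (1, 0), (1, 1), (0, 1). *)
Lemma pentagon_coplanar (x := (1, 0) : F * F) (xy := (1, 1) : F * F)
    (y := (0, 1) : F * F) :
  [/\ coplanar None (Some y) o, coplanar o None (Some x), coplanar (Some x) o (Some xy),
      coplanar (Some xy) (Some x) (Some y) & coplanar (Some y) (Some xy) None].
Proof.
rewrite {}/x {}/xy {}/y.
have coplanarI m r s : r != m -> s != m -> (exists i j k : F, pvec e s =
    i *: pvec e m + j *: qvec e m + k *: pvec e r) -> coplanar m r s.
  by move=> rm sm H; apply/coplanarP; split.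
have n10 : (1 : F) <> 0 by apply/eqP/oner_neq0.
have calc := (theta0, theta1, rv4Z, rv4D).
split; first by rewrite coplanar_None.
all: apply: coplanarI; try by apply/eqP; congruence.
all: rewrite /= /pnorm !calc.
- by exists 1, 1, 1; rewrite !calc; congr rv4; mod2.
- by exists 0, 1, 1; rewrite !calc; congr rv4; mod2.
- by exists 0, 1, 1; rewrite !calc; congr rv4; mod2.
by exists 1, 1, 1; rewrite !calc; congr rv4; mod2.
Qed.

(** The plane al Y + be X = 0 contains inf and the origin.  If al = 0 it contains the
spread line of inf.  Otherwise it contains the spread line of (x0, x0 c), where
c = be / al and theta x0 = c. *)
Lemma circle_coplanar_base (al be : F) : (al != 0) || (be != 0) ->
  exists a b, a != b /\
    forall s, (pvec e s *m cv4 0 al be 0 == 0) = (s == a) || coplanar a b s.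
Proof.
have dotE u v z y x w : (rv4 z y x w *m cv4 0 u v 0 == 0) = (y * u + x * v == 0).
  by rewrite rv4_cv4_eq0 !mulr0 add0r addr0.
have [-> /= be0 | al0 _] := eqVneq al 0.
  exists None, o; split=> // -[[x y]|].
    by rewrite coplanar_None /= dotE mulr0 add0r mulf_eq0 (negPf be0) orbF.
  by rewrite /= dotE !mul0r addr0 !eqxx.
pose c := be / al; pose x0 := c ^+ (2 ^ e).
have tx0 : t x0 = c := theta_root cardF c.
pose a := Some (x0, x0 * c).
exists a, None; split=> // s.
have -> : (pvec e s *m cv4 0 al be 0 == 0) =
          (if s is Some (x, y) then y == c * x else true).
  case: s => [[x y]|]; rewrite /= dotE ?mul0r ?addr0 ?eqxx //.
  have -> : y * al + x * be = al * (y + c * x).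
    by rewrite /c; field.
  by rewrite mulf_eq0 (negPf al0) /= addr_eq0 (oppr_pchar2 (card_finPcharP cardF _)).
case: s => [[x y]|]; last first.
  by symmetry; apply/orP; right; apply: coplanar_refl.
have [[-> ->]|sa] := eqVneq (Some (x, y)) a; first by rewrite mulrC eqxx.
apply/eqP/coplanarP=> [yE | [_ _ [i [j [k]]]]].
  split=> //; exists 1, (x + x0).
  exists (pnorm e x y - pnorm e x0 (x0 * c) - (x + x0) * (x0 * c + x0 * c)).
  by rewrite /= tx0 !rv4Z !rv4D yE; congr rv4; mod2.
rewrite /= tx0 !rv4Z !rv4D => /rv4_inj[_ -> ->].
by rewrite !mulr0 !mulr1 !addr0 => <-; ring.
Qed.

(** Two points of the plane are moved to inf and the origin, so that the first and
the last coefficient of the functional vanish. *)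
Lemma circle_coplanar (f : 'cV[F]_4) m r : f != 0 -> m != r ->
    pvec e m *m f = 0 -> pvec e r *m f = 0 ->
  exists a b, a != b /\ forall s, (pvec e s *m f == 0) = (s == a) || coplanar a b s.
Proof.
move=> f0 /baseP[g Gg -> -> _] fm fr; pose f' := GLval g *m f.
have f'E s : (pvec e s *m f' == 0) = (pvec e (ptmap g s) *m f == 0).
  have [c [d [k [c0 Ep _]]]] := ptmap_moves cardF s Gg.
  by rewrite /f' mulmxA Ep -scalemxAl scaler_eq0 (negPf c0).
have f'0 : f' != 0.
  apply: contraNneq f0 => f'0; rewrite -[f](mulKmx (GL_unit g)).
  by rewrite -/f' f'0 mulmx0.
have f'cv : f' = cv4 (f' 0 0) (f' 1 0) (f' 2%:R 0) (f' 3%:R 0).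
  by apply: trmx_inj; rewrite trmxK [LHS]rv4E !mxE.
have := f'E None; rewrite fm eqxx f'cv rv4_cv4_eq0 !mul0r mul1r !addr0 => /eqP f'0E.
have := f'E o; rewrite fr eqxx f'cv rv4_cv4_eq0 /pnorm theta0.
rewrite !(mulr0, mul0r, mul1r, add0r, addr0) => /eqP f'3E.
have [|a [b [ab abE]]] := @circle_coplanar_base (f' 1 0) (f' 2%:R 0).
  apply: contraNT f'0; rewrite negb_or !negbK => /andP[/eqP f'1 /eqP f'2].
  by rewrite f'cv f'0E f'1 f'2 f'3E; apply/eqP/colP=> i; rewrite !mxE;
    case: i => -[|[|[|[|]]]].
exists (ptmap g a), (ptmap g b); rewrite (inj_eq (ptmap_inj cardF Gg)); split=> // s.
rewrite -[s](ptmapVK cardF Gg) coplanar_ptmap // (inj_eq (ptmap_inj cardF Gg)) -abE -f'E.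
by rewrite {1}f'cv f'0E f'3E.
Qed.
End Circles.

(** * The stabiliser of a circle *)

Lemma ovoidE (F : finFieldType) (e : nat) : ovoid F e = pt e @: setT.
Proof.
apply/setP=> X; apply/setU1P/imsetP=> [[->|/imset2P[x y _ _ ->]]|[[[x y]|] _ ->]].
- by exists None.
- by exists (Some (x, y)).
- by right; apply/imset2P; exists x y.
by left.
Qed.

(** A nonzero column of the cokernel: its kernel contains the plane and has the same
rank. *)
Lemma plane_functional (F : finFieldType) k (A : 'M[F]_(k, 4)) : \rank A = 3%N ->
  exists2 f : 'cV[F]_4, f != 0 & forall v : 'rV_4, (v <= A)%MS = (v *m f == 0).
Proof.
move=> rA.
have /matrix0Pn[i [j Aij]] : cokermx A != 0 by rewrite -mxrank_eq0 mxrank_coker rA.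
pose f : 'cV_4 := cokermx A *m delta_mx j 0.
have f0 : f != 0 by apply/matrix0Pn; exists i, 0; rewrite /f -colE mxE.
exists f => // v; apply/idP/eqP=> [|/sub_kermxP vf].
  by rewrite submxE /f mulmxA => /eqP->; rewrite mul0mx.
have sAf : (A <= kermx f)%MS by apply/sub_kermxP; rewrite /f mulmxA mulmx_coker mul0mx.
apply: submx_trans vf _; rewrite -(geq_leqif (mxrank_leqif_sup sAf)) mxrank_ker rA.
by rewrite leq_subLR addnC -ltn_subLR // subnn lt0n mxrank_eq0.
Qed.

Section CircleStabiliser.
Variables (F : finFieldType) (e : nat).
Hypotheses (e_gt0 : (1 <= e)%N) (cardF : #|F| = (2 ^ (2 * e + 1))%N).
Local Notation G := (Sz F e).
Local Notation ptmap := (ptmap e).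
Local Notation coplanar := (coplanar e).
Local Notation to := (PG3act F).
Local Notation pt := (pt e).
Implicit Types (a b d m r s : option (F * F)).

Definition circle_of a b : {set {set 'rV[F]_4}} :=
  pt @: [set s | (s == a) || coplanar a b s].

Lemma circleP C : is_circle e C -> exists a b, a != b /\ C = circle_of a b.
Proof.
case=> P [[A rA ->] defC C_gt1]; have [f f0 fE] := plane_functional rA.
have memC s : (pt s \in C) = (pvec e s *m f == 0).
  by rewrite defC inE ovoidE imset_f ?inE // rowgS fE.
have CE X : X \in C -> exists2 s, X = pt s & pvec e s *m f = 0.
  move=> XC; have := XC; rewrite {1}defC inE ovoidE => /andP[/imsetP[s _ eX] _].
  by exists s => //; apply/eqP; rewrite -memC -eX.
have /card_gt1P[X [Y [/CE[m -> fm] /CE[r -> fr]]]] := C_gt1.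
rewrite (inj_eq (@pt_inj _ e)) => mr.
have [a [b [ab abE]]] := circle_coplanar cardF f0 mr fm fr.
exists a, b; split=> //; apply/setP=> Z; apply/idP/imsetP.
  by case/CE=> s -> fs; exists s => //; rewrite inE -abE fs.
by case=> s; rewrite inE -abE => fs ->; rewrite memC.
Qed.

Lemma mem_circle_of a b s : (pt s \in circle_of a b) = (s == a) || coplanar a b s.
Proof. by rewrite mem_imset ?inE //; apply: pt_inj. Qed.

Lemma mem_circle_stab a b g : g \in G -> ptmap g a = a -> coplanar a b (ptmap g b) ->
  g \in circle_stab e (circle_of a b).
Proof.
move=> Gg ga gb; rewrite inE Gg /= !inE /=; apply/subsetP=> X /imsetP[s].
rewrite !inE => abs ->; rewrite -(pt_ptmap cardF) // mem_circle_of.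
case/orP: abs => [/eqP->|abs]; first by rewrite ga eqxx.
by apply/orP; right; rewrite -(coplanar_class cardF _ gb) -{1}ga coplanar_ptmap.
Qed.

Variables (a b : option (F * F)).
Hypothesis ab : a != b.
Local Notation G1 := (circle_stab e (circle_of a b)).

Lemma cardF_gt2 : (2 < #|F|)%N.
Proof. by rewrite cardF (@ltn_exp2l 2 1) // addn1 ltnS muln_gt0. Qed.

(** A fixed point of the stabiliser must be the nucleus, because the elations with
centre the nucleus stabilise the circle and move every other point. *)
Lemma nucleus_eq m : #|orbit to G1 (pt m)| = 1%N -> m = a.
Proof.
move=> o1; apply: contraTeq isT => ma.
have am : a != m by rewrite eq_sym.
have : (1 < #|[set s | coplanar a m s]|)%N.
  by rewrite card_coplanar_class // (ltn_trans _ cardF_gt2).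
case/card_gt1P=> u [v []]; rewrite !inE => amu amv uv.
have [s ams sm] : exists2 s, coplanar a m s & s != m.
  by have [um|] := eqVneq u m; [exists v; rewrite // -um eq_sym | exists u].
have [g Gg [ga gm gcoplanar]] := elation cardF ams.
have G1g : g \in G1 by apply: mem_circle_stab => //; apply: gcoplanar; rewrite eq_sym.
have : (1 < #|orbit to G1 (pt m)|)%N.
  apply/card_gt1P; exists (pt s), (pt m); split; last by rewrite (inj_eq (@pt_inj _ e)).
    by apply/orbitP; exists g => //; rewrite -(pt_ptmap cardF) // gm.
  exact: orbit_refl.
by rewrite o1.
Qed.

Lemma orbit_circle_stab_sub d : d != a ->
  pt @: [set s | coplanar a d s] \subset orbit to G1 (pt d).
Proof.
move=> da; apply/subsetP=> X /imsetP[s]; rewrite inE => ads ->.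
have [g Gg [ga gd gcoplanar]] := elation cardF ads.
apply/orbitP; exists g; last by rewrite -(pt_ptmap cardF) // gd.
by apply: mem_circle_stab => //; apply: gcoplanar; rewrite eq_sym.
Qed.

(** Off the circle, the elations already give |F| points of the orbit, and a torus
element would supply a further one. *)
Lemma point_on_circle d : d != a -> #|orbit to G1 (pt d)| = #|F| -> coplanar a b d.
Proof.
move=> da od; apply/idPn=> abd.
have [g Gg [ga gb gd]] := homology cardF cardF_gt2 ab da abd.
have G1g : g \in G1 by apply: mem_circle_stab; rewrite ?gb ?coplanar_refl.
have : (pt (ptmap g d) |: pt @: [set s | coplanar a d s]) \subset orbit to G1 (pt d).
  rewrite subUset orbit_circle_stab_sub // sub1set andbT.
  by apply/orbitP; exists g => //; rewrite pt_ptmap.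
move/subset_leq_card; rewrite cardsU1 mem_imset ?inE ?gd; last exact: pt_inj.
by rewrite (card_imset _ (@pt_inj _ e)) card_coplanar_class 1?eq_sym // od add1n ltnn.
Qed.

(** The elations give one inclusion, and both sides have |F| elements. *)
Lemma orbit_circle_stab d : d != a -> #|orbit to G1 (pt d)| = #|F| ->
  orbit to G1 (pt d) = pt @: [set s | coplanar a d s].
Proof.
move=> da od; apply/esym/eqP; rewrite eqEcard orbit_circle_stab_sub // od.
by rewrite (card_imset _ (@pt_inj _ e)) card_coplanar_class 1?eq_sym // leqnn.
Qed.

End CircleStabiliser.

(** * The graph of the Suzuki group *)

Section CircleGraph.
Variables (F : finFieldType) (e : nat).
Hypotheses (e_gt0 : (1 <= e)%N) (cardF : #|F| = (2 ^ (2 * e + 1))%N).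
Variables (a d : option (F * F)).
Hypothesis ad : a != d.
Local Notation G := (Sz F e).
Local Notation ptmap := (ptmap e).
Local Notation coplanar := (coplanar e).
Local Notation to := (PG3act F).
Local Notation pt := (pt e).
Local Notation o := (Some (0, 0) : option (F * F)).
Local Notation G1 := (circle_stab e (circle_of e a d)).

Hypothesis fix_a : #|orbit to G1 (pt a)| = 1%N.
Hypothesis orbit_d : #|orbit to G1 (pt d)| = #|F|.

Let da : d != a. Proof. by rewrite eq_sym. Qed.
Let sG1G : G1 \subset G. Proof. exact: subsetIl. Qed.
Let G1G g : g \in G1 -> g \in G. Proof. exact: (subsetP sG1G). Qed.
Let orbitE := orbit_circle_stab cardF ad da orbit_d.

Lemma circle_stab_fix_nucleus g : g \in G1 -> ptmap g a = a.
Proof.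
move=> G1g; have /card_le1_eqP fix1 : (#|orbit to G1 (pt a)| <= 1)%N by rewrite fix_a.
apply: (@pt_inj _ e); rewrite (pt_ptmap cardF) ?G1G //.
by apply: fix1; rewrite ?orbit_refl // mem_orbit.
Qed.

Lemma circle_stab_coplanar g : g \in G1 -> coplanar a d (ptmap g d).
Proof.
move=> G1g; have : to (pt d) g \in orbit to G1 (pt d) by apply: mem_orbit.
rewrite orbitE -(pt_ptmap cardF) ?G1G // mem_imset ?inE //; exact: pt_inj.
Qed.

Local Notation cocircular := (cocircular to G G1 (pt a) (pt d)).

(** The relation of the abstract coset graph is the coplanarity relation: this and
[coplanar_cocircular] are the two directions. *)
Lemma cocircularE X Y Z : cocircular X Y Z ->
  exists m r s, [/\ X = pt m, Y = pt r, Z = pt s & coplanar m r s].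
Proof.
case=> x [h [Gx G1h -> -> ->]]; have Gh := G1G G1h.
exists (ptmap x a), (ptmap x d), (ptmap x (ptmap h d)).
rewrite !pt_ptmap // actM; split=> //.
by rewrite coplanar_ptmap // circle_stab_coplanar.
Qed.

Lemma coplanar_cocircular m r s : coplanar m r s -> cocircular (pt m) (pt r) (pt s).
Proof.
move=> mrs; have mr := coplanar_neq mrs.
have [x [Gx xa xd]] := Sz_2trans_pairs cardF ad mr.
have : pt (ptmap x^-1 s) \in orbit to G1 (pt d).
  rewrite orbitE mem_imset ?inE; last exact: pt_inj.
  by rewrite -(coplanar_ptmap cardF _ _ _ Gx) xa xd ptmapVK.
case/orbitP=> h G1h eqs; exists x, h; split=> //; rewrite ?actM ?eqs -?pt_ptmap ?xa ?xd //.
by rewrite ptmapVK.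
Qed.

Let stabE m g : g \in G -> (to (pt m) g == pt m) = (ptmap g m == m).
Proof. by move=> Gg; rewrite -(pt_ptmap cardF) // (inj_eq (@pt_inj _ e)). Qed.

Lemma card_orbit_Sz : #|orbit to G (pt a)| = (#|F| ^ 2 + 1)%N.
Proof.
have -> : orbit to G (pt a) = pt @: setT.
  apply/setP=> X; apply/orbitP/imsetP=> [[g Gg <-]|[m _ ->]].
    by exists (ptmap g a); rewrite ?pt_ptmap.
  have [g Gg ga] := Sz_trans_None cardF a; have [h Gh hm] := Sz_trans_None cardF m.
  exists (g * h^-1)%g; first by rewrite groupM ?groupV.
  by rewrite -(pt_ptmap cardF) ?groupM ?groupV // ptmapM ?groupV // ga -hm ptmapK.
by rewrite (card_imset _ (@pt_inj _ e)) cardsT card_option card_prod addn1.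
Qed.

Lemma card_orbit_Sz_stab : #|orbit to 'C_G[pt a | to] (pt d)| = (#|F| ^ 2)%N.
Proof.
have -> : orbit to 'C_G[pt a | to] (pt d) = pt @: [set~ a].
  apply/setP=> X; apply/orbitP/imsetP=> [[g /setIP[Gg /astab1P/eqP]]|[m]].
    rewrite stabE // => /eqP ga <-; exists (ptmap g d); last by rewrite pt_ptmap.
    by rewrite !inE -{1}ga (inj_eq (ptmap_inj cardF Gg)).
  rewrite !inE eq_sym => am ->; have [g [Gg ga gd]] := Sz_2trans_pairs cardF ad am.
  exists g; last by rewrite -(pt_ptmap cardF) // gd.
  by rewrite inE Gg; apply/astab1P/eqP; rewrite stabE // ga.
by rewrite (card_imset _ (@pt_inj _ e)) cardsC1 card_option card_prod.
Qed.

Theorem suzuki_graph_egr : exists lambda : nat,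
  (#|F| - 1 <= lambda)%N /\
  egr (suzuki_graph e (circle_of e a d) (pt a) (pt d)) (#|F| * (#|F| ^ 2 + 1))%N
      #|F| 5 lambda.
Proof.
have [tau [Gtau tau_a tau_d]] := Sz_2trans_pairs cardF ad da.
have [g Gg ga gd _] := baseP cardF ad.
pose f l := pt (ptmap g (Some (l, 0))).
have f_inj : injective f by move=> l l' /pt_inj/(ptmap_inj cardF Gg)[].
pose B := f @: [set~ 0].
have cardB : #|B| = (#|F| - 1)%N by rewrite (card_imset _ f_inj) cardsC1 subn1.
have F_gt2 := cardF_gt2 e_gt0 cardF.
rewrite -cardB; apply: (@nucleus_graph_egr _ _ _ to G G1 (pt a) (pt d) tau) => //.
- exact: subsetT.
- by move=> h G1h; rewrite -(pt_ptmap cardF) ?G1G // circle_stab_fix_nucleus.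
- move=> h Gh /eqP; rewrite stabE // => /eqP ha /eqP; rewrite stabE // => /eqP hd.
  by apply: mem_circle_stab => //; rewrite hd coplanar_refl.
- by rewrite (inj_eq (@pt_inj _ e)).
- by rewrite -(pt_ptmap cardF) // tau_a.
- by rewrite -(pt_ptmap cardF) // tau_d.
- by apply: ltn_trans F_gt2.
- by rewrite cardB subn_gt0 (ltn_trans _ F_gt2).
- exact: card_orbit_Sz.
- exact: card_orbit_Sz_stab.
- move=> X Y Z /cocircularE[m [r [s [-> -> -> mrs]]]].
  move=> /cocircularE[m' [r' [s' [/pt_inj<- /pt_inj<- /pt_inj<-]]]].
  exact: coplanar_no_triangle mrs.
- move=> X Y Z W /cocircularE[m [r [s [-> -> -> mrs]]]].
  move=> /cocircularE[m' [r' [s' [/pt_inj<- /pt_inj<- -> rms']]]].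
  move=> /cocircularE[m1 [r1 [s1 [/pt_inj<- /pt_inj<- /pt_inj<- s'rs]]]] neq.
  congr pt; apply: (coplanar_no_quadrangle cardF mrs rms' s'rs).
  by move=> eqs; rewrite eqs in neq.
move=> _ /imsetP[l /[!inE] l0 ->].
have [h [Gh hN hE]] := Sz_torus cardF l0.
have [c0 c1 c2 c3 c4] := pentagon_coplanar cardF.
pose k := (h * g)%g; have Gk : k \in G by rewrite groupM.
have kM m : ptmap k m = ptmap g (ptmap h m) by rewrite ptmapM.
have ka : pt a = pt (ptmap k None) by rewrite kM hN ga.
have kd : pt d = pt (ptmap k o) by rewrite kM hE !mulr0 gd.
have kl : f l = pt (ptmap k (Some (1, 0))) by rewrite kM hE mulr1 mulr0.
exists (pt (ptmap k (Some (1, 1)))), (pt (ptmap k (Some (0, 1)))).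
have kcoplanar m r s : coplanar m r s ->
    cocircular (pt (ptmap k m)) (pt (ptmap k r)) (pt (ptmap k s)).
  by move=> mrs; apply: coplanar_cocircular; rewrite coplanar_ptmap.
have := (kcoplanar _ _ _ c0, kcoplanar _ _ _ c1, kcoplanar _ _ _ c2,
         kcoplanar _ _ _ c3, kcoplanar _ _ _ c4).
rewrite -ka -kd -kl => -[[[[k0 k1] k2] k3] k4]; split=> //.
have pk_inj : injective (fun m => pt (ptmap k m))
  by move=> m r /pt_inj/(ptmap_inj cardF Gk).
have n10 : (1 : F) <> 0 by apply/eqP/oner_neq0.
rewrite ka kd kl (map_inj_uniq pk_inj [:: None; o; _; _; _]) /= !inE !negb_or.
by repeat (apply/andP; split); rewrite //; apply/eqP; congruence.
Qed.

End CircleGraph.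

Theorem mainTheorem4 (e : nat) (he : (1 <= e)%N) (F : finFieldType)
    (q : nat) (hq : q = (2 ^ (2 * e + 1))%N) (hF : #|F| = q)
    (C : {set {set 'rV[F]_4}}) (hC : is_circle e C)
    (n : {set 'rV[F]_4}) (hn : n \in ovoid F e)
    (hnuc : #|orbit (PG3act F) (circle_stab e C) n| = 1%N)
    (p : {set 'rV[F]_4}) (hp : p \in ovoid F e)
    (horb : #|orbit (PG3act F) (circle_stab e C) p| = q) :
  exists lambda : nat,
    (q - 1 <= lambda)%N /\
    egr (suzuki_graph e C n p) (q * (q ^ 2 + 1))%N q 5 lambda.
Proof.
have cardF : #|F| = (2 ^ (2 * e + 1))%N by rewrite hF hq.
have q_gt2 : (2 < q)%N by rewrite -hF (cardF_gt2 he cardF).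
have [a [b [ab eqC]]] := circleP cardF hC.
move: hn hp; rewrite !ovoidE => /imsetP[m _ eqn] /imsetP[d _ eqp].
rewrite {}eqC {}eqn {}eqp in hnuc horb *.
have eqm := nucleus_eq he cardF ab hnuc; rewrite {m}eqm in hnuc *.
have da : d != a by apply: contraTneq q_gt2 => eqd; rewrite -horb eqd hnuc.
have od : #|orbit (PG3act F) (circle_stab e (circle_of e a b)) (pt e d)| = #|F|.
  by rewrite horb hF.
have abd := point_on_circle he cardF ab da od.
have eqC : circle_of e a b = circle_of e a d.
  have setE : [set s | (s == a) || coplanar e a b s] =
              [set s | (s == a) || coplanar e a d s].
    by apply/setP=> s; rewrite !inE (coplanar_class cardF s abd).
  by rewrite /circle_of setE.
rewrite {}eqC in hnuc od *; have ad : a != d by rewrite eq_sym.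
by rewrite -hF; apply: (suzuki_graph_egr he cardF ad hnuc od).
Qed.
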